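(* Let $n\ge2$ and suppose $T_1,T_2\in\mathbb{T}_n$ have an upper bound in $\mathscr{C}_n$. Then $$\mathrm{ParseWords}(T_1,T_2)=\mathrm{ParseWords}(T_1\wedge T_2,\,T_1\vee T_2).$$
   Context: $\mathbb{T}_n$ is the set of all full plane binary trees with $n$ leaves (every internal vertex has exactly a left child and a right child); the leaves are labeled $a_1,\ldots,a_n$ from left to right. For $T\in\mathbb{T}_n$, the reduced parenthesization $RP_T$ is the set of all subsets of $\{a_1,\ldots,a_n\}$ which are leaf sets of the subtrees of $T$ rooted at vertices of $T$ and which do not contain $a_n$. The (right) comb poset $\mathscr{C}_n$ is the set $\mathbb{T}_n$ ordered by $T_1\le T_2$ if and only if $RP_{T_1}\subseteq RP_{T_2}$. $\wedge,\vee$ denote meet and join in $\mathscr{C}_n$ (these exist for trees having a common upper bound). A word $w=w_1\cdots w_n\in\{0,1,2\}^n$ is parsed by $T\in\mathbb{T}_n$ if the labeling of the leaves of $T$ by $w_1,\ldots,w_n$ from left to right extends to a labeling of all $2n-1$ vertices of $T$ by $\{0,1,2\}$ such that the two children of each internal vertex have distinct labels and no parent and child have the same label. $\mathrm{ParseWords}(T_1,\ldots,T_m)$ is the set of words $w\in\{0,1,2\}^n$ parsed by all of $T_1,\ldots,T_m$. *)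

(* Defs.v *)
From HB Require Import structures.
From mathcomp Require Import all_boot all_order.
From mathcomp Require Import zify.
From mathcomp Require Import boolp classical_sets.

Set Implicit Arguments.
Unset Strict Implicit.
Unset Printing Implicit Defensive.

Inductive btree : Type := Leaf | Node of btree & btree.

Fixpoint btree_encode (t : btree) : GenTree.tree void :=
  match t with
  | Leaf => GenTree.Node 0 [::]
  | Node l r => GenTree.Node 1 [:: btree_encode l; btree_encode r]
  end.

Fixpoint btree_decode (g : GenTree.tree void) : option btree :=
  match g with
  | GenTree.Node 0 [::] => Some Leaf
  | GenTree.Node 1 [:: gl; gr] =>
      if (btree_decode gl, btree_decode gr) is (Some l, Some r)
      then Some (Node l r) else None
  | _ => None
  end.

Lemma btree_encodeK : pcancel btree_encode btree_decode.
Proof. by elim=> //= l -> r ->. Qed.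

HB.instance Definition _ := Choice.copy btree (pcan_type btree_encodeK).

Fixpoint nleaves (t : btree) : nat :=
  if t is Node l r then nleaves l + nleaves r else 1.

Definition plane_tree (n : nat) : Type := {t : btree | nleaves t == n}.

HB.instance Definition _ n :=
  Choice.copy (plane_tree n) {t : btree | nleaves t == n}.

(* The leaf a_(i+1) is represented by its index i, counted from 0.  The list
   [leafsets k t] has one entry per vertex v of t: the indices of the leaves
   below v, when the leftmost leaf of t has index k. *)
Fixpoint leafsets (k : nat) (t : btree) : seq (seq nat) :=
  iota k (nleaves t) ::
  if t is Node l r then leafsets k l ++ leafsets (k + nleaves l) r else [::].

(* The condition [i.+1 != n] says that the leaf i is not a_n. *)
Definition RP (n : nat) (T : plane_tree n) : {set {set 'I_n}} :=
  [set A : {set 'I_n} |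
     has (fun s => A == [set i : 'I_n | val i \in s]) (leafsets 0 (val T))
     && [forall i in A, i.+1 != n]].

Lemma nleaves_gt0 t : 0 < nleaves t.
Proof. by elim: t => //= l hl r hr; rewrite addn_gt0 hl. Qed.

Lemma leafsetsP k t s : s \in leafsets k t ->
  exists a b, [/\ s = iota a b, 0 < b, k <= a & a + b <= k + nleaves t].
Proof.
elim: t k => [|l IHl r IHr] k.
  by rewrite inE => /eqP ->; exists k, 1; split.
rewrite inE => /orP[/eqP ->|].
  by exists k, (nleaves (Node l r)); split=> //; apply: nleaves_gt0.
rewrite mem_cat => /orP[/IHl|/IHr] [a [b [-> hb ha hab]]];
  exists a, b; split=> //=; lia.
Qed.

Lemma leafsets_root k t : iota k (nleaves t) \in leafsets k t.
Proof. by case: t => [|l r] /=; rewrite inE eqxx. Qed.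

Lemma iota_inj a b a' b' : 0 < b -> iota a b = iota a' b' -> a = a' /\ b = b'.
Proof.
move=> hb e; have := congr1 size e; rewrite !size_iota => eb; subst b'.
by case: b hb e => // b _ [].
Qed.

Lemma leafsets_bounds k t a b : 0 < b -> iota a b \in leafsets k t ->
  k <= a /\ a + b <= k + nleaves t.
Proof.
move=> hb /leafsetsP[a' [b' [e hb' ha hab]]].
by have [? ?] := iota_inj hb e; subst a' b'.
Qed.

Lemma leafsets_node k l r a b : 0 < b -> a + b < k + nleaves (Node l r) ->
  (iota a b \in leafsets k (Node l r)) =
  (iota a b \in leafsets k l) || (iota a b \in leafsets (k + nleaves l) r).
Proof.
move=> hb hab; rewrite [leafsets _ _]/= in_cons mem_cat.
by case: eqP => // /(iota_inj hb)[ea eb]; move: hab => /=; lia.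
Qed.

Lemma reduced_inj t t' k : nleaves t = nleaves t' ->
  (forall a b, 0 < b -> a + b < k + nleaves t ->
     (iota a b \in leafsets k t) = (iota a b \in leafsets k t')) -> t = t'.
Proof.
elim: t t' k => [|l IHl r IHr] [|l' r'] k //.
- by have := nleaves_gt0 l'; have := nleaves_gt0 r'; move=> /=; lia.
- by have := nleaves_gt0 l; have := nleaves_gt0 r; move=> /=; lia.
move=> en H.
have gl := nleaves_gt0 l; have gr := nleaves_gt0 r.
have gl' := nleaves_gt0 l'; have gr' := nleaves_gt0 r'.
have H2 a b : 0 < b -> a + b < k + (nleaves l + nleaves r) ->
    (iota a b \in leafsets k l) || (iota a b \in leafsets (k + nleaves l) r) =
    (iota a b \in leafsets k l') || (iota a b \in leafsets (k + nleaves l') r').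
  by move=> hb hab; rewrite -!leafsets_node ?H // -?en.
move: en => /= en.
have le1 : nleaves l <= nleaves l'.
  have := H2 k (nleaves l) gl; rewrite leafsets_root /= => /(_ ltac:(lia)).
  by move=> /esym/orP[] /(leafsets_bounds gl); lia.
have le2 : nleaves l' <= nleaves l.
  have := H2 k (nleaves l') gl'; rewrite leafsets_root /= => /(_ ltac:(lia)).
  by move=> /orP[] /(leafsets_bounds gl'); lia.
have el : nleaves l = nleaves l' by lia.
congr Node.
- apply: (IHl _ k) => // a b hb hab.
  have := H2 a b hb ltac:(lia).
  have /negPf-> : iota a b \notin leafsets (k + nleaves l) r.
    by apply/negP => /(leafsets_bounds hb); lia.
  have /negPf-> : iota a b \notin leafsets (k + nleaves l') r'.
    by apply/negP => /(leafsets_bounds hb); lia.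
  by rewrite !orbF.
- apply: (IHr _ (k + nleaves l)) => [|a b hb hab]; first by lia.
  have [ha|ha] := leqP (k + nleaves l) a; last first.
    by apply/idP/idP => /(leafsets_bounds hb); lia.
  have := H2 a b hb ltac:(lia).
  have /negPf-> : iota a b \notin leafsets k l.
    by apply/negP => /(leafsets_bounds hb); lia.
  have /negPf-> : iota a b \notin leafsets k l'.
    by apply/negP => /(leafsets_bounds hb); lia.
  by rewrite -el.
Qed.

Lemma set_iota_inj n a b a' b' : 0 < b -> a + b <= n -> a' + b' <= n ->
  [set i : 'I_n | val i \in iota a b] = [set i : 'I_n | val i \in iota a' b'] ->
  iota a b = iota a' b'.
Proof.
move=> hb hn hn' e.
have E x : x < n -> (x \in iota a b) = (x \in iota a' b').
  by move=> hx; have := congr1 (fun A : {set 'I_n} => Ordinal hx \in A) e; rewrite !inE.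
apply: (irr_sorted_eq ltn_trans ltnn); rewrite ?iota_ltn_sorted // => x.
have [/E//|hx] := ltnP x n.
by rewrite !mem_iota; lia.
Qed.

Lemma mem_RP n (T : plane_tree n) a b : 0 < b -> a + b < n ->
  ([set i : 'I_n | val i \in iota a b] \in RP T) =
  (iota a b \in leafsets 0 (val T)).
Proof.
move=> hb hab; rewrite inE.
have -> : [forall i in [set i : 'I_n | val i \in iota a b], i.+1 != n].
  by apply/'forall_implyP => i; rewrite inE mem_iota /= => /andP[]; lia.
rewrite andbT; apply/hasP/idP => [[s sT /eqP e]|h]; last by exists (iota a b).
have [a' [b' [es hb' _]]] := leafsetsP sT; rewrite (eqP (valP T)) => hab'.
by subst s; rewrite (set_iota_inj hb _ _ e) //; lia.
Qed.

Lemma RP_inj n : injective (@RP n).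
Proof.
move=> T T' e; apply/val_inj/(@reduced_inj _ _ 0) => [|a b hb].
  by rewrite (eqP (valP T)) (eqP (valP T')).
by rewrite (eqP (valP T)) add0n => hab; rewrite -!mem_RP // e.
Qed.

Definition comb_le n (T1 T2 : plane_tree n) : bool := RP T1 \subset RP T2.

Lemma comb_le_refl n : reflexive (@comb_le n).
Proof. by move=> T; apply: subxx. Qed.

Lemma comb_le_anti n : antisymmetric (@comb_le n).
Proof. by move=> T1 T2 h; apply/RP_inj/eqP; rewrite finset.eqEsubset. Qed.

Lemma comb_le_trans n : transitive (@comb_le n).
Proof. by move=> T2 T1 T3; apply: fintype.subset_trans. Qed.

Fact comb_display : Order.disp_t. Proof. exact: (Order.Disp tt tt). Qed.

(* The comb poset C_n is the type [plane_tree n] with this order. *)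
HB.instance Definition _ n := Order.Le_isPOrder.Build comb_display
  (plane_tree n) (@comb_le_refl n) (@comb_le_anti n) (@comb_le_trans n).

Lemma comb_leE n (T1 T2 : plane_tree n) :
  (T1 <= T2)%O = (RP T1 \subset RP T2).
Proof. by []. Qed.

(* C_n is not a lattice, so meets and joins are given by their universal
   property; by antisymmetry of the order they are unique when they exist. *)
Definition is_meet d (P : porderType d) (x y m : P) : Prop :=
  [/\ (m <= x)%O, (m <= y)%O &
      forall z : P, (z <= x)%O -> (z <= y)%O -> (z <= m)%O].

Definition is_join d (P : porderType d) (x y j : P) : Prop :=
  [/\ (x <= j)%O, (y <= j)%O &
      forall z : P, (x <= z)%O -> (y <= z)%O -> (j <= z)%O].

(* Plane binary trees all of whose vertices carry a label in L. *)
Inductive ltree (L : Type) : Type :=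
  | LLeaf of L
  | LNode of L & ltree L & ltree L.

Arguments LLeaf {L}.
Arguments LNode {L}.

Fixpoint ltree_shape L (t : ltree L) : btree :=
  if t is LNode _ l r then Node (ltree_shape l) (ltree_shape r) else Leaf.

Definition root_label L (t : ltree L) : L :=
  match t with LLeaf a => a | LNode a _ _ => a end.

Fixpoint leaf_word L (t : ltree L) : seq L :=
  match t with
  | LLeaf a => [:: a]
  | LNode _ l r => leaf_word l ++ leaf_word r
  end.

Fixpoint ltree_proper (L : eqType) (t : ltree L) : bool :=
  if t is LNode a l r then
    [&& root_label l != root_label r, a != root_label l, a != root_label r,
        ltree_proper l & ltree_proper r]
  else true.

Definition parsed n (T : plane_tree n) (w : n.-tuple 'I_3) : Prop :=
  exists t : ltree 'I_3,
    [/\ ltree_shape t = val T, leaf_word t = tval w & ltree_proper t].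

Definition ParseWords n (Ts : seq (plane_tree n)) : set (n.-tuple 'I_3) :=
  [set w | forall T, T \in Ts -> parsed T w]%classic.

(* Main.v *)
(** Identify the three labels with the nonzero elements of the Klein four-group.
    Then three labels are pairwise distinct iff each is the sum of the other two,
    so the label of a vertex is forced to be the sum of the leaves below it, and
    a word is parsed by [T] iff no vertex of [T] has leaf sum zero.  It therefore
    suffices that T1, T2 together have the same leaf sets as T1 /\ T2, T1 \/ T2.

    A tree below [U] in the comb poset is an order ideal of [RP U], so the meet
    and the join have reduced parenthesizations [RP T1 :&: RP T2] and
    [RP T1 :|: RP T2].  The remaining leaf sets are final segments; the one
    starting at [a] occurs in [T] iff no member of [RP T] straddles [a].  As the
    members of [RP U] are pairwise nested or disjoint, [a] is straddled in the
    meet iff it is in both T1 and T2, and in the join iff it is in one of them. *)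
Require Import Defs.
From mathcomp Require Import all_boot all_order.
From mathcomp Require Import zify.
From mathcomp Require Import boolp classical_sets.

Set Implicit Arguments.
Unset Strict Implicit.
Unset Printing Implicit Defensive.

(** * Leaf intervals of a tree as a maximal laminar family *)

(* The arguments are the start and length of each interval, as in [iota]. *)
Definition laminar a b c d : bool :=
  [|| a + b <= c, c + d <= a, (a <= c) && (c + d <= a + b)
    | (c <= a) && (a + b <= c + d)].

Lemma leafsets_laminar k t a b c d : 0 < b -> 0 < d ->
  iota a b \in leafsets k t -> iota c d \in leafsets k t -> laminar a b c d.
Proof.
rewrite /laminar; move=> hb hd; elim: t k => [|l IHl r IHr] k hab hcd;
  have hab' := leafsets_bounds hb hab; have hcd' := leafsets_bounds hd hcd.
  by move: hab' hcd' => /=; lia.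
move: hab hcd; rewrite !in_cons !mem_cat.
case/or3P=> [/eqP/(iota_inj hb)[ea eb]|hl|hr]; first by move: eb hab' hcd' => /=; lia.
- case/or3P=> [/eqP/(iota_inj hd)[ec ed]|hl'|hr'].
  + by move: ed hab' hcd' => /=; lia.
  + exact: IHl hl hl'.
  + by have := leafsets_bounds hb hl; have := leafsets_bounds hd hr'; lia.
- case/or3P=> [/eqP/(iota_inj hd)[ec ed]|hl'|hr'].
  + by move: ed hab' hcd' => /=; lia.
  + by have := leafsets_bounds hb hr; have := leafsets_bounds hd hl'; lia.
  + exact: IHr hr hr'.
Qed.

(** Descend into a child as long as it contains the interval. An interval that crosses the boundary
    between two children and is laminar with both must contain both, so it is the interval of their
    parent. *)
Lemma leafsets_maximal k t a b :
  0 < b -> k <= a -> a + b <= k + nleaves t ->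
  (forall c d, 0 < d -> iota c d \in leafsets k t -> laminar a b c d) ->
  iota a b \in leafsets k t.
Proof.
move=> hb; elim: t k => [|l IHl r IHr] k ha hab hlam.
  have [-> ->] : a = k /\ b = 1 by move: hab => /=; lia.
  by rewrite mem_head.
have gl := nleaves_gt0 l; have gr := nleaves_gt0 r.
have [hl|hl] := leqP (a + b) (k + nleaves l).
  rewrite /= in_cons mem_cat IHl ?orbT // => c d hd hcd.
  by apply: hlam; rewrite // in_cons mem_cat hcd orbT.
have [hr|hr] := leqP (k + nleaves l) a.
  rewrite /= in_cons mem_cat IHr ?orbT // => [|c d hd hcd].
    by move: hab => /=; lia.
  by apply: hlam; rewrite // in_cons mem_cat hcd !orbT.
have := hlam k (nleaves l) gl; have := hlam (k + nleaves l) (nleaves r) gr.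
rewrite /= !in_cons !mem_cat !leafsets_root !orbT /laminar => /(_ isT) h1 /(_ isT) h2.
have [-> ->] : a = k /\ b = nleaves l + nleaves r by move: hab => /=; lia.
by rewrite eqxx.
Qed.

Lemma leafsets_subtree k t a b : 0 < b -> iota a b \in leafsets k t ->
  exists2 s, nleaves s = b & {subset leafsets a s <= leafsets k t}.
Proof.
move=> hb; elim: t k => [|l IHl r IHr] k.
  by rewrite inE => /eqP/(iota_inj hb)[-> ->]; exists Leaf.
rewrite in_cons mem_cat => /or3P[/eqP/(iota_inj hb)[-> ->]|hl|hr].
- by exists (Node l r).
- have [s es hs] := IHl _ hl; exists s => // u /hs hu.
  by rewrite /= in_cons mem_cat hu orbT.
- have [s es hs] := IHr _ hr; exists s => // u /hs hu.
  by rewrite /= in_cons mem_cat hu !orbT.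
Qed.

Lemma leafsets_leaf k t a : k <= a < k + nleaves t -> iota a 1 \in leafsets k t.
Proof.
by move=> ha; apply: leafsets_maximal => // [||c d hd _]; rewrite /laminar; lia.
Qed.

(** Any interval of [t] reaching the last leaf is nested with this final segment. One that stops
    earlier violates laminarity exactly when it straddles [a], so maximality gives the criterion. *)
Lemma leafsets_suffix k t a b : 0 < b -> k <= a -> a + b = k + nleaves t ->
  (forall c d, 0 < d -> c + d < k + nleaves t -> iota c d \in leafsets k t ->
     ~~ (c < a < c + d)) <->
  iota a b \in leafsets k t.
Proof.
move=> hb ha hab; split=> [h|h c d hd hcd hc].
  apply: leafsets_maximal => //; first by lia.
  move=> c d hd hc; have hcd := leafsets_bounds hd hc.
  have [lt|ge] := ltnP (c + d) (k + nleaves t); rewrite /laminar; last by lia.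
  by have := h c d hd lt hc; lia.
by have := leafsets_laminar hb hd h hc; rewrite /laminar; lia.
Qed.

(** * Realizing order ideals by pruning *)

(* [prune P k t rest] hangs on the right spine, to the left of [rest], the
   maximal subtrees of [t] whose leaf interval satisfies [P]. *)
Fixpoint prune (P : nat -> nat -> bool) (k : nat) (t rest : btree) : btree :=
  if P k (nleaves t) then Node t rest else
  if t is Node l r then prune P k l (prune P (k + nleaves l) r rest)
  else Node t rest.

(** The right spine is always opened, down to the last leaf, since only intervals avoiding that leaf
    are selected by [P]. *)
Fixpoint prune_spine (P : nat -> nat -> bool) (k : nat) (t : btree) : btree :=
  if t is Node l r then prune P k l (prune_spine P (k + nleaves l) r) else Leaf.

(** The bound on [a + b] mirrors the exclusion of the last leaf in [RP]. *)
Definition ideal (P : nat -> nat -> bool) (k : nat) (t : btree) : Prop :=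
  forall a b c d, 0 < b -> 0 < d -> a + b < k + nleaves t ->
  iota a b \in leafsets k t -> iota c d \in leafsets k t ->
  a <= c -> c + d <= a + b -> P a b -> P c d.

Lemma nleaves_prune P k t rest : nleaves (prune P k t rest) = nleaves t + nleaves rest.
Proof.
elim: t k rest => [|l IHl r IHr] k rest /=; case: ifP => //= _.
by rewrite IHl IHr addnA.
Qed.

Lemma nleaves_prune_spine P k t : nleaves (prune_spine P k t) = nleaves t.
Proof. by elim: t k => [|l _ r IHr] k //=; rewrite nleaves_prune IHr. Qed.

(** A kept subtree has all its intervals in [P] by downward closure. The spine vertices created by
    pruning reach the end of [rest], which the strict bound on [a + b] excludes. *)
Lemma leafsets_prune (P : nat -> nat -> bool) k t rest a b :
  (forall c, k <= c < k + nleaves t -> P c 1) ->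
  (forall a b c d, 0 < b -> 0 < d ->
     iota a b \in leafsets k t -> iota c d \in leafsets k t ->
     a <= c -> c + d <= a + b -> P a b -> P c d) ->
  0 < b -> a + b < k + nleaves t + nleaves rest ->
  (iota a b \in leafsets k (prune P k t rest)) =
  (iota a b \in leafsets k t) && P a b || (iota a b \in leafsets (k + nleaves t) rest).
Proof.
move=> P1 Pdown hb; elim: t k rest P1 Pdown => [|l IHl r IHr] k rest P1 Pdown hab.
  rewrite /prune if_same leafsets_node // ?addnA //.
  congr (_ || _); case: (boolP (iota a b \in _)) => [|//].
  by rewrite inE => /eqP/(iota_inj hb)[-> ->]; rewrite P1 //=; lia.
rewrite [prune _ _ _ _]/=; case: ifP => hP.
  rewrite leafsets_node //; last by rewrite [nleaves (Node _ rest)]/= addnA.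
  congr (_ || _); case: (boolP (iota a b \in _)) => [hin|//].
  rewrite andTb; have [h1 h2] := leafsets_bounds hb hin.
  apply/esym/(Pdown k (nleaves (Node l r))) => //; last exact: leafsets_root.
  exact: nleaves_gt0.
have mem_l u : u \in leafsets k l -> u \in leafsets k (Node l r).
  by move=> h; rewrite /= in_cons mem_cat h orbT.
have mem_r u : u \in leafsets (k + nleaves l) r -> u \in leafsets k (Node l r).
  by move=> h; rewrite /= in_cons mem_cat h !orbT.
rewrite /= in hab.
rewrite IHl; first last.
- by rewrite nleaves_prune; lia.
- by move=> a' b' c d h1 h2 /mem_l h3 /mem_l h4; apply: Pdown.
- by move=> c hc; apply: P1 => /=; lia.
rewrite IHr; first last.
- by lia.
- by move=> a' b' c d h1 h2 /mem_r h3 /mem_r h4; apply: Pdown.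
- by move=> c hc; apply: P1 => /=; lia.
rewrite /= in_cons mem_cat addnA orbA -andb_orl; congr (_ || _).
(* The interval of the opened node disappears, but it fails [P]. *)
case: (boolP (iota a b == _)) => //= /eqP/(iota_inj hb)[-> ->].
by rewrite hP !andbF.
Qed.

Lemma leafsets_prune_spine (P : nat -> nat -> bool) k t a b :
  (forall c, k <= c < k + nleaves t -> P c 1) -> ideal P k t ->
  0 < b -> a + b < k + nleaves t ->
  (iota a b \in leafsets k (prune_spine P k t)) = (iota a b \in leafsets k t) && P a b.
Proof.
move=> P1 Pdown hb; elim: t k P1 Pdown => [|l IHl r IHr] k P1 Pdown hab.
  suff /negPf-> : iota a b \notin leafsets k Leaf by [].
  by apply/negP => /(leafsets_bounds hb); move: hab => /=; lia.
have gr := nleaves_gt0 r.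
have mem_l u : u \in leafsets k l -> u \in leafsets k (Node l r).
  by move=> h; rewrite /= in_cons mem_cat h orbT.
have mem_r u : u \in leafsets (k + nleaves l) r -> u \in leafsets k (Node l r).
  by move=> h; rewrite /= in_cons mem_cat h !orbT.
rewrite leafsets_node // [prune_spine _ _ _]/=; rewrite /= in hab.
rewrite leafsets_prune // ?nleaves_prune_spine; first last.
- by lia.
- move=> a' b' c d h1 h2 h3 h4.
  (* Intervals of [l] end before the last leaf of [r], as [ideal] demands. *)
  have h5 := leafsets_bounds h1 h3.
  by apply: Pdown; rewrite ?mem_l //=; lia.
- by move=> c hc; apply: P1 => /=; lia.
rewrite IHr; first by rewrite andb_orl.
- by move=> c hc; apply: P1 => /=; lia.
- move=> a' b' c d h1 h2 h h3 h4.
  by apply: Pdown; rewrite ?mem_r //=; lia.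
- by lia.
Qed.

(** * The comb order in terms of intervals *)

Lemma le_leafsets n (T U : plane_tree n) a b : (T <= U)%O -> 0 < b -> a + b < n ->
  iota a b \in leafsets 0 (val T) -> iota a b \in leafsets 0 (val U).
Proof.
rewrite comb_leE => /fintype.subsetP TU hb hab.
by rewrite -!mem_RP //; apply: TU.
Qed.

(** Let [s] be the subtree of [T] with the outer interval. Its leaf sets all occur in [U], so they
    are laminar with the inner interval, which by maximality occurs in [s]. *)
Lemma le_ideal n (T U : plane_tree n) : (T <= U)%O ->
  ideal (fun a b => iota a b \in leafsets 0 (val T)) 0 (val U).
Proof.
move=> TU a b c d hb hd; rewrite (eqP (valP U)) add0n => hab _ cdU ac cdab abT.
have [s es hs] := leafsets_subtree hb abT.
apply/hs/leafsets_maximal => //; first by rewrite es.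
move=> x y hy hxy; have hb' := leafsets_bounds hy hxy.
apply: (leafsets_laminar hd hy cdU (le_leafsets TU hy _ (hs _ hxy))).
by lia.
Qed.

Lemma exists_ideal_tree n (U : plane_tree n) (P : nat -> nat -> bool) :
  (forall c, c < n -> P c 1) -> ideal P 0 (val U) ->
  exists T : plane_tree n, forall a b, 0 < b -> a + b < n ->
    (iota a b \in leafsets 0 (val T)) = (iota a b \in leafsets 0 (val U)) && P a b.
Proof.
move=> P1 Pdown; have eU := eqP (valP U).
have hT : nleaves (prune_spine P 0 (val U)) == n by rewrite nleaves_prune_spine eU.
exists (exist (fun t => nleaves t == n) _ hT) => a b hb hab.
by apply: leafsets_prune_spine; rewrite ?eU.
Qed.

Lemma RP_interval n (T : plane_tree n) A : A \in RP T ->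
  exists a b, [/\ 0 < b, a + b < n & A = [set i : 'I_n | val i \in iota a b]].
Proof.
rewrite inE => /andP[/hasP[s /leafsetsP[a [b [-> hb _]]]]].
rewrite add0n (eqP (valP T)) => hab /eqP -> /'forall_implyP hA.
exists a, b; split=> //.
(* This is the last index of the interval; as it is not [n.-1], the bound on [a + b] becomes
   strict. *)
have lt : a + b.-1 < n by lia.
have := hA (Ordinal lt); rewrite inE mem_iota /= => /(_ ltac:(lia)); lia.
Qed.

Lemma subset_RP n (T : plane_tree n) (S : {set {set 'I_n}}) :
  (forall a b, 0 < b -> a + b < n -> iota a b \in leafsets 0 (val T) ->
     [set i : 'I_n | val i \in iota a b] \in S) ->
  RP T \subset S.
Proof.
move=> h; apply/fintype.subsetP => A AT.
by have [a [b [hb hab e]]] := RP_interval AT; rewrite e h // -mem_RP // -e.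
Qed.

(** * Parsing as nonvanishing of Klein four-group sums *)

(* The value of a word in the Klein four-group, where 0, 1 and 2 stand for
   (1, 0), (0, 1) and (1, 1). *)
Definition klein_sum (s : seq 'I_3) : bool * bool :=
  (odd (count (fun x : 'I_3 => val x != 1) s),
   odd (count (fun x : 'I_3 => val x != 0) s)).

Definition klein_nonzero (s : seq 'I_3) : bool := klein_sum s != (false, false).

Lemma klein_sum_cat s1 s2 : klein_sum (s1 ++ s2) =
  ((klein_sum s1).1 (+) (klein_sum s2).1, (klein_sum s1).2 (+) (klein_sum s2).2).
Proof. by rewrite /klein_sum !count_cat !oddD. Qed.

Lemma klein_nonzero_label s : klein_nonzero s ->
  exists x, klein_sum [:: x] = klein_sum s.
Proof.
rewrite /klein_nonzero; case: (klein_sum s) => [[] []] // _.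
- by exists (inord 2); rewrite /klein_sum /= inordK.
- by exists (inord 0); rewrite /klein_sum /= inordK.
- by exists (inord 1); rewrite /klein_sum /= inordK.
Qed.

Lemma distinct_klein_sum (x y z : 'I_3) :
  [&& y != z, x != y & x != z] = (klein_sum [:: x] == klein_sum [:: y; z]).
Proof. by case: x y z => [[|[|[|]]] //= ?] [[|[|[|]]] //= ?] [[|[|[|]]] //= ?]. Qed.

Lemma klein_sum_root t : ltree_proper t ->
  klein_sum [:: root_label t] = klein_sum (leaf_word t).
Proof.
elim: t => //= x l IHl r IHr /and5P[h1 h2 h3 /IHl hl /IHr hr].
have /eqP -> : klein_sum [:: x] == klein_sum ([:: root_label l] ++ [:: root_label r]).
  by rewrite -distinct_klein_sum h1 h2.
by rewrite !klein_sum_cat hl hr.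
Qed.

Lemma klein_nonzero1 x : klein_nonzero [:: x].
Proof. by case: x => [[|[|[|]]]]. Qed.

(** Indexing letters by absolute leaf position lets the same [f] serve both children in the
    induction. *)
Lemma proper_labelling_iff (f : nat -> 'I_3) k t :
  (exists lt : ltree 'I_3, [/\ ltree_shape lt = t,
     leaf_word lt = map f (iota k (nleaves t)) & ltree_proper lt]) <->
  all (fun u => klein_nonzero (map f u)) (leafsets k t).
Proof.
split.
  case=> lt []; elim: lt t k => [x|x l IHl r IHr] t k <- //=.
    by case=> <- _; rewrite klein_nonzero1.
  rewrite iotaD map_cat => /eqP; rewrite eqseq_cat.
    move=> /andP[/eqP el /eqP er] hp; case/and5P: (hp) => _ _ _ pl pr.
    rewrite all_cat (IHl _ k erefl el pl) (IHr _ _ erefl er pr) !andbT.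
    rewrite -el -er /klein_nonzero -(@klein_sum_root (LNode x l r)) //.
    exact: klein_nonzero1.
  rewrite size_map size_iota.
  by elim: {IHl IHr r} l => //= y l1 IH1 l2 IH2; rewrite size_cat IH1 IH2.
elim: t k => [|l IHl r IHr] k.
  by exists (LLeaf (f k)).
rewrite [leafsets _ _]/= [all _ _]/= all_cat.
case/and3P=> /klein_nonzero_label[x ex] /IHl[lt [sl el pl]] /IHr[rt [sr er pr]].
exists (LNode x lt rt); split; first by rewrite /= sl sr.
  by rewrite /= iotaD map_cat el er.
(* By induction the root labels of the children equal their leaf sums, and [x] was chosen as the
   total. *)
have : klein_sum [:: x] == klein_sum [:: root_label lt; root_label rt].
  rewrite ex /= iotaD map_cat -[[:: root_label lt; _]]cat1s !klein_sum_cat.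
  by rewrite (klein_sum_root pl) (klein_sum_root pr) el er.
by rewrite -distinct_klein_sum /= pl pr !andbT.
Qed.

(** The default [ord0] is never read: leaf indices of [T] are below [n]. *)
Lemma parsed_iff n (T : plane_tree n) (w : n.-tuple 'I_3) :
  parsed T w <->
  {in leafsets 0 (val T), forall u, klein_nonzero (map (nth ord0 w) u)}.
Proof.
have -> : {in leafsets 0 (val T), forall u, klein_nonzero (map (nth ord0 w) u)} <->
          all (fun u => klein_nonzero (map (nth ord0 w) u)) (leafsets 0 (val T)).
  by split=> /allP.
rewrite -proper_labelling_iff (eqP (valP T)).
suff -> : [seq nth ord0 w i | i <- iota 0 n] = tval w by [].
by rewrite -{2}(size_tuple w) -/(mkseq _ _) mkseq_nth.
Qed.

(** * Final segments in the meet and the join *)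

Lemma leafsets_suffix_meet_join n (T1 T2 U M J : plane_tree n) a b :
  (T1 <= U)%O -> (T2 <= U)%O ->
  (forall a b, 0 < b -> a + b < n -> (iota a b \in leafsets 0 (val M)) =
     (iota a b \in leafsets 0 (val T1)) && (iota a b \in leafsets 0 (val T2))) ->
  (forall a b, 0 < b -> a + b < n -> (iota a b \in leafsets 0 (val J)) =
     (iota a b \in leafsets 0 (val T1)) || (iota a b \in leafsets 0 (val T2))) ->
  0 < b -> a + b = n ->
  (iota a b \in leafsets 0 (val T1)) || (iota a b \in leafsets 0 (val T2)) =
  (iota a b \in leafsets 0 (val M)) || (iota a b \in leafsets 0 (val J)).
Proof.
move=> U1 U2 eM eJ hb hab.
have suffix (T : plane_tree n) : (forall c d, 0 < d -> c + d < n ->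
    iota c d \in leafsets 0 (val T) -> ~~ (c < a < c + d)) <->
    iota a b \in leafsets 0 (val T).
  by rewrite -leafsets_suffix // (eqP (valP T)).
apply/idP/idP => [h|].
  apply/orP; left; apply/suffix => c d hd hcd; rewrite eM // => /andP[c1 c2].
  by case/orP: h => /suffix; apply.
case/orP=> h; last first.
  apply/orP; left; apply/suffix => c d hd hcd c1.
  by move/suffix: h; apply; rewrite // eJ // c1.
apply: contraT => /norP[/negP n1 /negP n2].
have straddle (T : plane_tree n) : ~ iota a b \in leafsets 0 (val T) ->
    exists c d, [/\ 0 < d, c + d < n, iota c d \in leafsets 0 (val T) & c < a < c + d].
  move=> nT; apply/not_existsP => h'; apply/nT/suffix => c d hd hcd hc.
  by apply/negP => hacd; apply: (h' c); exists d.
have [c [d [hd hcd c1 hacd]]] := straddle _ n1.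
have [c' [d' [hd' hcd' c2 hacd']]] := straddle _ n2.
have cU := le_leafsets U1 hd hcd c1; have cU' := le_leafsets U2 hd' hcd' c2.
(* Both intervals straddle [a], so they overlap and must be nested in [U]. The inner one then lies
   in both trees, hence in [M], where it straddles [a]. *)
have := leafsets_laminar hd hd' cU cU'; rewrite /laminar => /or4P[||/andP[]|/andP[]].
- by lia.
- by lia.
- move=> le1 le2; have m : iota c' d' \in leafsets 0 (val M).
    by rewrite eM // c2 (le_ideal U1 hd hd' _ cU cU' le1 le2) ?(eqP (valP U)).
  by have := proj2 (suffix M) h c' d' hd' hcd' m; rewrite hacd'.
- move=> le1 le2; have m : iota c d \in leafsets 0 (val M).
    by rewrite eM // c1 (le_ideal U2 hd' hd _ cU' cU le1 le2) ?(eqP (valP U)).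
  by have := proj2 (suffix M) h c d hd hcd m; rewrite hacd.
Qed.

(** * Meet, join and equality of the parsed words *)

Theorem theorem7p9 (n : nat) (T1 T2 : plane_tree n) :
  (2 <= n)%N ->
  (exists U : plane_tree n, (T1 <= U)%O /\ (T2 <= U)%O) ->
  exists M J : plane_tree n,
    [/\ is_meet T1 T2 M, is_join T1 T2 J
      & ParseWords [:: T1; T2] = ParseWords [:: M; J]].
Proof.
move=> _ [U [U1 U2]].
have leaf (T : plane_tree n) c : c < n -> iota c 1 \in leafsets 0 (val T).
  by move=> hc; apply: leafsets_leaf; rewrite (eqP (valP T)).
(* Intersections and unions of ideals of [U] are ideals, which yields [M] and then [J]. *)
have [||M eM'] := @exists_ideal_tree n U (fun a b =>
    (iota a b \in leafsets 0 (val T1)) && (iota a b \in leafsets 0 (val T2))).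
- by move=> c hc; rewrite !leaf.
- move=> a b c d hb hd hab hU hU' le1 le2 /andP[h1 h2]; apply/andP; split.
    exact: (le_ideal U1 hb hd hab hU hU').
  exact: (le_ideal U2 hb hd hab hU hU').
have [||J eJ'] := @exists_ideal_tree n U (fun a b =>
    (iota a b \in leafsets 0 (val T1)) || (iota a b \in leafsets 0 (val T2))).
- by move=> c hc; rewrite leaf.
- move=> a b c d hb hd hab hU hU' le1 le2 /orP[h|h]; apply/orP; [left|right].
    exact: (le_ideal U1 hb hd hab hU hU').
  exact: (le_ideal U2 hb hd hab hU hU').
have eM a b : 0 < b -> a + b < n -> (iota a b \in leafsets 0 (val M)) =
    (iota a b \in leafsets 0 (val T1)) && (iota a b \in leafsets 0 (val T2)).
  move=> hb hab; rewrite eM' //; apply/andb_idl => /andP[h _].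
  exact: le_leafsets h.
have eJ a b : 0 < b -> a + b < n -> (iota a b \in leafsets 0 (val J)) =
    (iota a b \in leafsets 0 (val T1)) || (iota a b \in leafsets 0 (val T2)).
  move=> hb hab; rewrite eJ' //; apply/andb_idl => /orP[] h.
    exact: (le_leafsets U1).
  exact: (le_leafsets U2).
exists M, J; split.
- split=> [||Z Z1 Z2]; rewrite comb_leE; apply: subset_RP => a b hb hab;
    rewrite mem_RP // ?eM //; try by case/andP.
  by move=> h; rewrite (le_leafsets Z1) // (le_leafsets Z2).
- split=> [||Z Z1 Z2]; rewrite comb_leE; apply: subset_RP => a b hb hab;
    rewrite mem_RP // ?eJ //; try by move=> ->; rewrite ?orbT.
  by case/orP; apply: le_leafsets.
have nleaves_val (T : plane_tree n) : nleaves (val T) = n by exact: eqP (valP T).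
have same u : (u \in leafsets 0 (val T1)) || (u \in leafsets 0 (val T2)) =
              (u \in leafsets 0 (val M)) || (u \in leafsets 0 (val J)).
  have [/or4P interval|] := boolP [|| u \in leafsets 0 (val T1),
      u \in leafsets 0 (val T2), u \in leafsets 0 (val M) | u \in leafsets 0 (val J)];
    last by rewrite !negb_or => /and4P[/negPf-> /negPf-> /negPf-> /negPf->].
  have : exists a b, [/\ u = iota a b, 0 < b & a + b <= n].
    case: interval => /leafsetsP[a [b []]];
      by rewrite nleaves_val => ? ? _ ?; exists a, b.
  (* Final segments need the straddling argument; for the other intervals the claim is Boolean
     absorption. *)
  case=> a [b [-> hb]]; rewrite leq_eqVlt => /orP[/eqP hab|hab].
    exact: (leafsets_suffix_meet_join U1 U2).
  by rewrite eM // eJ //; do 2!case: (_ \in _).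
have parse2 (A B : plane_tree n) w : ParseWords [:: A; B] w <->
    forall u, (u \in leafsets 0 (val A)) || (u \in leafsets 0 (val B)) ->
      klein_nonzero (map (nth ord0 w) u).
  split=> [h u|h T].
    by case/orP; move: u; apply/parsed_iff/h; rewrite !inE eqxx ?orbT.
  by rewrite !inE => /orP[]/eqP->; apply/parsed_iff => u hu; apply: h; rewrite hu ?orbT.
apply/seteqP; split=> w /parse2 h; apply/parse2 => u hu; apply: h.
  by rewrite same.
by rewrite -same.
Qed.
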